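(* Let $q\ge 2$, let $T$ be a $q$-regular tree, let $\mathcal{F}$ be a forest consisting of two planar rooted $q$-regular trees, let $e$ be an edge of $T$, and let $i\colon\mathcal{F}\to T$ be an embedding sending $\mathcal{F}$ onto $T\setminus e$. Then the Neretin group $N_q$ is generated by $\operatorname{Aut}^+(T)$ and $G^i_{q,2}$.
   Context: A tree is $q$-regular if every vertex has degree $q+1$; in a rooted $q$-regular tree, instead, the root has degree $q$ and all other vertices have degree $q+1$. A rooted tree is planar if the set of children of each vertex carries a fixed linear order. Isomorphisms of planar rooted trees preserve roots and these orders. The boundary $\partial T$ of a tree is its set of ends (rays modulo agreeing after removal of finite initial segments) with its usual compact topology; the boundary of a forest is the disjoint union of the boundaries of its trees. Neretin group: a finite $q$-regular subtree $F\subseteq T$ is a finite subtree each of whose vertices has degree (in $F$) either $1$ (a leaf) or $q+1$ (an internal vertex). For such a nonempty $F$, $T\setminus F$ denotes the forest of rooted $q$-regular trees obtained from $T$ by removing all edges and all internal vertices of $F$, with the leaves of $F$ as roots; $\partial(T\setminus F)=\partial T$. In particular, for an edge $e$, $T\setminus e$ consists of two rooted $q$-regular trees with the endpoints of $e$ as roots. An isomorphism of (rooted) forests $\phi\colon T\setminus F_1\to T\setminus F_2$ induces a homeomorphism $\phi_*$ of $\partial T$, called a spheromorphism. $N_q$ is the group of all spheromorphisms of $\partial T$. $\operatorname{Aut}(T)$ embeds naturally in $N_q$ via its action on $\partial T$ and is identified with its image. Type-preserving automorphisms: fix a $2$-coloring of the vertices of $T$ (adjacent vertices having different colors). $\operatorname{Aut}^+(T)\le\operatorname{Aut}(T)$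 is the subgroup of automorphisms preserving the color (type) of every vertex. Higman-Thompson group $G_{q,2}$: let $T_1,T_2$ be the two planar trees of $\mathcal{F}$. For $k=1,2$ choose finite subtrees $F_k,F_k'\subseteq T_k$ containing the root of $T_k$, such that for each vertex of the subtree either all or none of its $q$ children in $T_k$ belong to the subtree (vertices with none are leaves, the others internal). Let $\mathcal{F}_1=\mathcal{F}\setminus(F_1\cup F_2)$ and $\mathcal{F}_2=\mathcal{F}\setminus(F_1'\cup F_2')$ be obtained by removing edges and internal vertices of these subtrees, with their leaves as roots, and assume that $\mathcal{F}_1$ and $\mathcal{F}_2$ have the same number of trees. Each isomorphism of planar forests $\phi\colon\mathcal{F}_1\to\mathcal{F}_2$ (realizing an arbitrary bijection between the sets of trees) induces a homeomorphism $\phi_*$ of $\partial\mathcal{F}$. $G_{q,2}$ is the group of all such homeomorphisms. The embedding $i$ is an isomorphism of forests from $\mathcal{F}$ onto $T\setminus e$ and induces a homeomorphism $i_*\colon\partial\mathcal{F}\to\partial T$. Put $G^i_{q,2}=\{i_*\circ\Phi\circ i_*^{-1}:\Phi\in G_{q,2}\}\le N_q$. *)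

(* Defs.v *)
From HB Require Import structures.
From mathcomp Require Import all_boot finmap.
From mathcomp Require Import boolp classical_sets functions cardinality.
Set Implicit Arguments.
Unset Strict Implicit.
Unset Printing Implicit Defensive.

Local Open Scope classical_set_scope.
Local Open Scope card_scope.

(* The group of all bijections of a type X, with product f * g = f \o g.      *)
Record bij (X : Type) := Bij {
  bij_fun :> X -> X;
  bij_inv : X -> X;
  bij_funK : cancel bij_fun bij_inv;
  bij_invK : cancel bij_inv bij_fun
}.

Section BijGroup.
Variable X : Type.
Implicit Types f g h : bij X.

Lemma bijP f g : (f : X -> X) =1 g -> f = g.
Proof.
case: f g => [f f' fK f'K] [g g' gK g'K] /= /funext efg; subst g.
have /funext e : f' =1 g' by move=> x; rewrite -{1}[x]g'K fK.
by subst g'; congr Bij; exact: Prop_irrelevance.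
Qed.

Definition bij_one : bij X := @Bij X id id (fun=> erefl) (fun=> erefl).
Definition bij_mul f g : bij X :=
  Bij (can_comp (bij_funK f) (bij_funK g)) (can_comp (bij_invK g) (bij_invK f)).
Definition bij_opp f : bij X := Bij (bij_invK f) (bij_funK f).

Fact bij_mulA : associative bij_mul. Proof. by move=> f g h; exact: bijP. Qed.
Fact bij_mul1 : left_id bij_one bij_mul. Proof. by move=> f; exact: bijP. Qed.
Fact bij_1mul : right_id bij_one bij_mul. Proof. by move=> f; exact: bijP. Qed.
Fact bij_mulV : left_inverse bij_one bij_opp bij_mul.
Proof. by move=> f; apply: bijP => x; exact: bij_funK. Qed.
Fact bij_Vmul : right_inverse bij_one bij_opp bij_mul.
Proof. by move=> f; apply: bijP => x; exact: bij_invK. Qed.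

HB.instance Definition _ := gen_eqMixin (bij X).
HB.instance Definition _ := gen_choiceMixin (bij X).
HB.instance Definition _ := isGroup.Build (bij X)
  bij_mulA bij_mul1 bij_1mul bij_mulV bij_Vmul.
End BijGroup.

Definition generated_subgroup (G : groupType) (S : set G) : set G :=
  smallest (fun H : set G => group_closed (mem H)) S.

Section Graphs.
Variable V : choiceType.
Implicit Types (adj : rel V) (x y : V) (S : {fset V}).

Definition joined adj x y : Prop := exists2 p, path adj x p & last x p = y.

(* A sequence [:: x; y] with x adjacent to y is a [ucycle] of the symmetric
   relation adj, whence the bound 2. *)
Definition acyclic adj : Prop := forall c, ucycle adj c -> size c <= 2.

Definition regular_tree (q : nat) adj : Prop :=
  [/\ symmetric adj, irreflexive adj, forall x y, joined adj x y, acyclic adj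
    & forall x, [set y | adj x y] #= `I_q.+1].

Definition two_coloring adj (c : V -> bool) : Prop :=
  forall x y, adj x y -> c x != c y.

(* A subtree of a tree or forest is an induced subgraph, so it is given by its
   vertex set. *)
Definition fconnected adj S : Prop :=
  forall x y, x \in S -> y \in S ->
    exists p, [/\ path adj x p, last x p = y & {subset p <= S}].

Definition is_ray adj (r : nat -> V) : Prop :=
  injective r /\ forall n, adj (r n) (r n.+1).

Definition tail_eq (r s : nat -> V) : Prop :=
  exists m n, forall k, r (m + k) = s (n + k).

(* The boundary of an acyclic graph; the boundary of a forest, seen as one
   graph, is the disjoint union of the boundaries of its components. *)
Record ends adj := End {
  end_rays : set (nat -> V);
  _ : exists2 r, is_ray adj r &
        end_rays = [set s | is_ray adj s /\ tail_eq r s]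
}.

Record rforest :=
  RForest { rf_vert : pred V; rf_adj : rel V; rf_root : pred V }.

Implicit Types A : rforest.

Definition child A : rel V := fun x y =>
  `[< exists rho p, [/\ rf_root A rho, path (rf_adj A) rho (rcons p y),
        uniq (rho :: rcons p y) & last rho p = x] >].

Definition regular_rforest (q : nat) A : Prop :=
  [/\ [/\ symmetric (rf_adj A), irreflexive (rf_adj A),
          forall x y, rf_adj A x y -> rf_vert A x && rf_vert A y
        & {subset rf_root A <= rf_vert A}],
      acyclic (rf_adj A),
      forall x, rf_vert A x ->
        exists! rho, rf_root A rho /\ joined (rf_adj A) rho x
    & forall x, rf_vert A x ->
        [set y | rf_adj A x y] #= `I_(if rf_root A x then q else q.+1)].

Definition planar A (le : rel V) : Prop :=
  forall x, rf_vert A x ->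
    [/\ {in child A x, reflexive le}, {in child A x &, antisymmetric le},
        {in child A x & &, transitive le} & {in child A x &, total le}].

(* Removal of all edges and all vertices but the leaves of the subtree S. The
   remaining vertices of S become roots. *)
Definition cut (vert : pred V) adj S (leaf : pred V) : rforest :=
  let kept x := vert x && ~~ ((x \in S) && ~~ leaf x) in
  RForest kept
    (fun x y => [&& kept x, kept y, adj x y & ~~ ((x \in S) && (y \in S))])
    (fun x => (x \in S) && leaf x).

Definition subdegree adj S x : nat := #|` [fset y in S | adj x y]%fset |.

Definition finite_regular_subtree (q : nat) adj S : Prop :=
  [/\ S != fset0, fconnected adj S
    & forall x, x \in S -> subdegree adj S x = 1 \/ subdegree adj S x = q.+1].

Definition tree_minus adj S : rforest :=
  cut predT adj S (fun x => subdegree adj S x == 1).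

Definition rooted_subtree A (rho : V) S : Prop :=
  [/\ rho \in S, fconnected (rf_adj A) S
    & forall x, x \in S -> (forall y, child A x y -> y \in S) \/
                           (forall y, child A x y -> y \notin S)].

Definition rforest_minus A S : rforest :=
  cut (rf_vert A) (rf_adj A) S (fun x => all (fun y => ~~ child A x y) S).

End Graphs.

Definition rforest_iso (V W : choiceType) (A : rforest V) (B : rforest W)
    (phi : V -> W) : Prop :=
  [/\ set_bij [set` rf_vert A] [set` rf_vert B] phi,
      {in rf_vert A &, {mono phi : x y / rf_adj A x y >-> rf_adj B x y}}
    & {in rf_vert A, {mono phi : x / rf_root A x >-> rf_root B x}}].

Definition planar_iso (V W : choiceType) (A : rforest V) (leA : rel V)
    (B : rforest W) (leB : rel W) (phi : V -> W) : Prop :=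
  rforest_iso A B phi /\
  forall x, rf_vert A x ->
    {in child A x &, {mono phi : y z / leA y z >-> leB y z}}.

(* f = phi_*, for phi a map defined on the subgraph with adjacency a. When every
   end contains a ray of that subgraph (as for the complement of a finite
   subtree), there is at most one such f. No continuity is required of f: the
   boundary map of an isomorphism of complement forests is a homeomorphism. *)
Definition induced (V W : choiceType) (adjV : rel V) (adjW : rel W) (a : rel V)
    (phi : V -> W) (f : ends adjV -> ends adjW) : Prop :=
  forall (E : ends adjV) r,
    end_rays E r -> is_ray a r -> end_rays (f E) (phi \o r).

Section Groups.
Variables (V : choiceType) (adj : rel V).

Definition Neretin (q : nat) : set (bij (ends adj)) :=
  [set f : bij (ends adj) | exists F1 F2 phi,
     [/\ finite_regular_subtree q adj F1, finite_regular_subtree q adj F2,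
         rforest_iso (tree_minus adj F1) (tree_minus adj F2) phi
       & induced (rf_adj (tree_minus adj F1)) phi f]].

Definition Aut_plus (c : V -> bool) : set (bij (ends adj)) :=
  [set f : bij (ends adj) | exists alpha : V -> V,
     [/\ bijective alpha, {mono alpha : x y / adj x y},
         {mono alpha : x / c x} & induced adj alpha f]].

Variables (W : choiceType) (A : rforest W) (le : rel W) (r1 r2 : W).

(* The group G_{q,2} of the planar forest A with the two roots r1 and r2. That
   the two complements have the same number of trees follows from the
   isomorphism phi, which restricts to a bijection between their roots. *)
Definition Higman_Thompson : set (bij (ends (rf_adj A))) :=
  [set f : bij (ends (rf_adj A)) | exists F1 F2 F1' F2' phi,
     let A1 := rforest_minus A (F1 `|` F2)%fset in
     let A2 := rforest_minus A (F1' `|` F2')%fset in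
     [/\ rooted_subtree A r1 F1 /\ rooted_subtree A r2 F2,
         rooted_subtree A r1 F1' /\ rooted_subtree A r2 F2',
         planar_iso A1 le A2 le phi & induced (rf_adj A1) phi f]].

Definition Higman_Thompson_embedded (i : W -> V) : set (bij (ends adj)) :=
  [set g : bij (ends adj) | exists2 Phi, Higman_Thompson Phi &
     exists (istar : ends (rf_adj A) -> ends adj)
            (istar' : ends adj -> ends (rf_adj A)),
       [/\ induced (rf_adj A) i istar, cancel istar istar', cancel istar' istar
         & g =1 istar \o Phi \o istar']].

End Groups.

Arguments Neretin {V} adj q.
Arguments Aut_plus {V} adj c.
Arguments Higman_Thompson_embedded {V} adj {W} A le r1 r2 i.

(* Main.v *)
Require Import Defs.
From mathcomp Require Import all_boot finmap.
From mathcomp Require Import boolp classical_sets functions cardinality.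
From mathcomp Require Import zify.

(** Every spheromorphism is a product of one element of the Higman-Thompson
    group and one type-preserving automorphism; generation follows at once.

    The planar structure of the forest numbers the children of every vertex of
    T minus e ([forest_coordinates]), so a vertex of T is one of the two ends of
    e followed by a word in 0, ..., q - 1. Let f be a spheromorphism. Choose n
    so large that f is induced by an isomorphism phi from the complement of the
    ball of radius n around e onto the complement of a finite regular subtree F
    that also contains e ([spheromorphism_complement]). Below each leaf of the
    ball, phi carries children to children ([phi_kid]) but may disturb their
    order. The disturbance is undone level by level: there is an automorphism
    alpha of T that fixes the ball pointwise and permutes, below it, the
    children of each vertex in such a way that phi \o alpha respects the
    numbering ([relabel], [phi_relabel_kid]). As alpha fixes e it preserves the
    colours, and phi \o alpha is an isomorphism of planar forests, so f is the
    product of an element of the Higman-Thompson group with the inverse of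
    alpha ([spheromorphism_factor]).

    It remains to see that the spheromorphisms form a group that contains both
    generating sets. This is easy for the maps of ends induced by an isomorphism
    between complements of arbitrary finite sets of vertices
    ([spheromorphism_group]), since such isomorphisms can be composed without
    refining subtrees. They are the elements of the Neretin group
    ([Neretin_spheromorphism]): enlarging the removed set of the source to a
    ball forces the removed set of the target to be a regular subtree. The
    reason is [phi_kid_neq_up]: if phi reversed one edge pointing away from e it
    would reverse all edges below it, and the resulting path towards e would
    never arrive. *)

Set Implicit Arguments.
Unset Strict Implicit.
Unset Printing Implicit Defensive.

Local Open Scope classical_set_scope.

(** * Ends and the maps between them *)

Section Ends.
Variables (V : choiceType) (adj : rel V).
Implicit Types (r s t : nat -> V) (E : ends adj).

Lemma tail_eq_refl r : tail_eq r r.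
Proof. by exists 0, 0. Qed.

Lemma tail_eq_sym r s : tail_eq r s -> tail_eq s r.
Proof. by case=> m [n h]; exists n, m => k. Qed.

Lemma tail_eq_trans s r t : tail_eq r s -> tail_eq s t -> tail_eq r t.
Proof.
case=> m [n h] [m' [n' h']]; exists (m + m'), (n' + n) => k.
by rewrite -addnA h addnCA h' addnA.
Qed.

Lemma tail_eq_shift r N : tail_eq r (fun k => r (N + k)).
Proof. by exists N, 0. Qed.

Lemma tail_eq_comp (W : choiceType) (h : V -> W) r s :
  tail_eq r s -> tail_eq (h \o r) (h \o s).
Proof. by case=> m [n e]; exists m, n => k /=; rewrite e. Qed.

Lemma is_ray_shift r N : is_ray adj r -> is_ray adj (fun k => r (N + k)).
Proof.
by case=> ri ra; split=> [k l /ri/addnI //|k]; rewrite addnS; exact: ra.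
Qed.

Lemma end_ray E : exists r, end_rays E r.
Proof.
case: E => R [r rr eR]; exists r; rewrite /= eR.
by split=> //; exact: tail_eq_refl.
Qed.

Lemma end_rays_is_ray E r : end_rays E r -> is_ray adj r.
Proof. by case: E => R [r0 _ eR] /=; rewrite eR => -[]. Qed.

Lemma end_rays_tail E r s : end_rays E r -> end_rays E s -> tail_eq r s.
Proof.
case: E => R [r0 _ eR] /=; rewrite eR => -[_ h] [_]; apply: tail_eq_trans.
exact: tail_eq_sym.
Qed.

Lemma end_rays_closed E r s :
  end_rays E r -> is_ray adj s -> tail_eq r s -> end_rays E s.
Proof.
case: E => R [r0 _ eR] /=; rewrite eR => -[_ h] sr rs; split=> //.
exact: tail_eq_trans rs.
Qed.

Lemma end_inj E E' r : end_rays E r -> end_rays E' r -> E = E'.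
Proof.
move=> Er E'r; have : end_rays E = end_rays E'.
  apply/seteqP; split=> s Es.
    by apply: (end_rays_closed E'r (end_rays_is_ray Es) (end_rays_tail Er Es)).
  by apply: (end_rays_closed Er (end_rays_is_ray Es) (end_rays_tail E'r Es)).
case: E E' {Er E'r} => R RP [R' R'P] /= e; subst R'.
by congr End; exact: Prop_irrelevance.
Qed.

Lemma exists_end r : is_ray adj r -> exists E, end_rays E r.
Proof.
move=> rr.
have P : exists2 r0, is_ray adj r0 &
  [set s | is_ray adj s /\ tail_eq r s] = [set s | is_ray adj s /\ tail_eq r0 s].
  by exists r.
by exists (End P); split=> //; exact: tail_eq_refl.
Qed.

(** A ray visits each vertex once, so it leaves every finite set for good. *)
Lemma end_ray_avoid E (S : {fset V}) :
  exists2 r, end_rays E r & forall n, r n \notin S.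
Proof.
have [r Er] := end_ray E; have [ri ra] := end_rays_is_ray Er.
suff [N h] : exists N, forall k, r (N + k) \notin S.
  exists (fun k => r (N + k)) => //.
  by apply: end_rays_closed Er (is_ray_shift _ _) (tail_eq_shift _ _).
have [N h] : exists N, forall x, x \in enum_fset S -> forall k, r (N + k) != x.
  elim: (enum_fset S) => [|x s [N IH]]; first by exists 0.
  have [[m e]|no] := pselect (exists m, r m = x).
    exists (N + m.+1) => y; rewrite inE => /predU1P[->|ys] k.
      by apply/eqP; rewrite -e => /ri; lia.
    by rewrite -addnA; exact: IH.
  exists N => y; rewrite inE => /predU1P[->|ys] k; last exact: IH.
  by apply/eqP => e; apply: no; exists (N + k).
by exists N => k; apply/negP => /h/(_ k)/eqP.
Qed.

End Ends.

(** Two rays of one end have a common tail, and then so have their images: a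
    single ray per end with a good image determines the whole map. The vertex
    map may be arbitrary elsewhere, as it is outside a complement forest. *)
Lemma exists_end_map (V W : choiceType) (adjV : rel V) (adjW : rel W)
    (h : V -> W) :
  (forall E : ends adjV, exists2 r, end_rays E r & is_ray adjW (h \o r)) ->
  exists f : ends adjV -> ends adjW, forall E r,
    end_rays E r -> is_ray adjW (h \o r) -> end_rays (f E) (h \o r).
Proof.
move=> hr.
have {hr} /choice[f hf] : forall E : ends adjV, exists E' : ends adjW,
    exists2 r, end_rays E r & end_rays E' (h \o r).
  by move=> E; have [r Er /exists_end[E' E'r]] := hr E; exists E', r.
exists f => E r Er hr; have [s Es fEs] := hf E.
exact: end_rays_closed fEs hr (tail_eq_comp _ (end_rays_tail Es Er)).
Qed.

Lemma exists_end_bij (V W : choiceType) (adjV : rel V) (adjW : rel W)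
    (h : V -> W) (k : W -> V) :
    (forall E : ends adjV, exists r,
      [/\ end_rays E r, is_ray adjW (h \o r) & k \o (h \o r) = r]) ->
    (forall E : ends adjW, exists r,
      [/\ end_rays E r, is_ray adjV (k \o r) & h \o (k \o r) = r]) ->
  exists (f : ends adjV -> ends adjW) (g : ends adjW -> ends adjV),
    [/\ cancel f g, cancel g f,
        forall E r, end_rays E r -> is_ray adjW (h \o r) -> end_rays (f E) (h \o r)
      & forall E r, end_rays E r -> is_ray adjV (k \o r) -> end_rays (g E) (k \o r)].
Proof.
move=> hh hk.
have [|f fh] := @exists_end_map _ _ adjV adjW h.
  by move=> E; have [r [Er hr _]] := hh E; exists r.
have [|g gk] := @exists_end_map _ _ adjW adjV k.
  by move=> E; have [r [Er hr _]] := hk E; exists r.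
exists f, g; split=> // E.
- have [r [Er hr e]] := hh E; apply: (end_inj _ Er).
  by rewrite -e; apply: gk; [exact: fh | rewrite e; exact: end_rays_is_ray Er].
- have [r [Er hr e]] := hk E; apply: (end_inj _ Er).
  by rewrite -e; apply: fh; [exact: gk | rewrite e; exact: end_rays_is_ray Er].
Qed.

Lemma is_ray_map (V W : choiceType) (adjV : rel V) (adjW : rel W)
    (P : V -> Prop) (h : V -> W) (r : nat -> V) :
  (forall x y, P x -> P y -> h x = h y -> x = y) ->
  (forall x y, P x -> P y -> adjV x y -> adjW (h x) (h y)) ->
  is_ray adjV r -> (forall n, P (r n)) -> is_ray adjW (h \o r).
Proof.
move=> hi ha [ri ra] Pr; split=> [m n|n] /=; last exact: ha.
by move/hi => e; apply: ri; exact: e.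
Qed.

(** * The group of spheromorphisms *)

(** Arbitrary finite sets S and S' instead of finite regular subtrees make
    composition immediate; the subtrees are recovered afterwards. *)
Definition spheromorphism (V : choiceType) (adj : rel V) (f : Defs.bij (ends adj)) :=
  exists (S S' : {fset V}) (phi phi' : V -> V),
  [/\ forall x, x \notin S -> phi x \notin S' /\ phi' (phi x) = x,
      forall y, y \notin S' -> phi' y \notin S /\ phi (phi' y) = y,
      forall x y, x \notin S -> y \notin S -> adj (phi x) (phi y) = adj x y
    & forall E r, end_rays E r -> (forall n, r n \notin S) ->
        end_rays (f E) (phi \o r)].

Section SpheromorphismGroup.
Variables (V : choiceType) (adj : rel V).
Implicit Types f g : Defs.bij (ends adj).

Lemma spheromorphism1 : spheromorphism (1%g : Defs.bij (ends adj)).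
Proof. by exists fset0, fset0, id, id; split. Qed.

Lemma spheromorphismV f : spheromorphism f -> spheromorphism f^-1%g.
Proof.
case=> S [S' [phi [phi' [h1 h2 h3 h4]]]]; exists S', S, phi', phi; split=> //.
  move=> x y xS yS; have [? e] := h2 _ xS; have [? e'] := h2 _ yS.
  by rewrite -{2}e -{2}e' h3.
move=> E r Er rS.
have hr : is_ray adj (phi' \o r).
  apply: (@is_ray_map _ _ adj _ (fun x => x \notin S')) => //.
  - by move=> x y /h2[_ {2}<-] /h2[_ {2}<-] ->.
  - move=> x y /h2[? e] /h2[? e']; by rewrite -{1}e -{1}e' h3.
  - exact: end_rays_is_ray Er.
have [E' E'r] := exists_end hr.
suff -> : E = f E' by rewrite [(f^-1)%g _]bij_funK.
apply: end_inj Er _.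
have := h4 _ _ E'r (fun n => proj1 (h2 _ (rS n))).
by congr end_rays; apply/funext => n /=; case: (h2 _ (rS n)).
Qed.

(** The composite is defined off S and off the preimage of T. The difference
    with S' is taken because phi' is meaningful only off S'. *)
Lemma spheromorphismM f g :
  spheromorphism f -> spheromorphism g -> spheromorphism (f * g)%g.
Proof.
case=> T [T' [psi [psi' [k1 k2 k3 k4]]]] [S [S' [phi [phi' [h1 h2 h3 h4]]]]].
pose U := (S `|` [fset phi' x | x in T `\` S'])%fset.
pose U' := (T' `|` [fset psi x | x in S' `\` T])%fset.
have US x : x \notin U -> x \notin S /\ phi x \notin T.
  rewrite in_fsetU negb_or => /andP[xS xT]; split=> //.
  apply: contra xT => pT; have [? e] := h1 _ xS.
  by apply/imfsetP; exists (phi x) => //=; rewrite inE pT andbT.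
have U'T x : x \notin U' -> x \notin T' /\ psi' x \notin S'.
  rewrite in_fsetU negb_or => /andP[xT xS]; split=> //.
  apply: contra xS => pS; have [? e] := k2 _ xT.
  by apply/imfsetP; exists (psi' x) => //=; rewrite inE pS andbT.
exists U, U', (psi \o phi), (phi' \o psi'); split => /=.
- move=> x /US[xS pT]; have [? e] := h1 _ xS; have [? e'] := k1 _ pT.
  rewrite e' e; split=> //; rewrite in_fsetU negb_or; apply/andP; split=> //.
  apply/imfsetP => -[y /=]; rewrite inE => /andP[yT yS'] eq.
  have [_] := k1 _ yT; rewrite -eq e' => ey.
  by rewrite -ey (negbTE (proj1 (h1 _ xS))) in yS'.
- move=> x /U'T[xS pT]; have [? e] := k2 _ xS; have [? e'] := h2 _ pT.
  rewrite e' e; split=> //; rewrite in_fsetU negb_or; apply/andP; split=> //.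
  apply/imfsetP => -[y /=]; rewrite inE => /andP[yT yS'] eq.
  have [_] := h2 _ yT; rewrite -eq e' => ey.
  by rewrite -ey (negbTE (proj1 (k2 _ xS))) in yS'.
- by move=> x y /US[xS pT] /US[yS pT']; rewrite k3 ?h3.
- move=> E r Er rU.
  apply: (k4 (g E) (phi \o r)) => [|n]; last by case: (US _ (rU n)).
  by apply: h4 => // n; case: (US _ (rU n)).
Qed.

Lemma spheromorphism_group :
  group_closed (mem [set f : Defs.bij (ends adj) | spheromorphism f]).
Proof.
split; first by rewrite inE; exact: spheromorphism1.
move=> f g; rewrite !inE /= => hf /spheromorphismV; exact: spheromorphismM.
Qed.

End SpheromorphismGroup.

(** The remaining vertices of S are the roots of the complement forest, and an
    isomorphism matches roots with roots; so vertices outside S go outside S',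
    where cutting has not changed adjacency. *)
Lemma cut_iso_off (V : choiceType) (vert leaf leaf' : pred V) (adj : rel V)
    (S S' : {fset V}) (phi : V -> V) :
    rforest_iso (cut vert adj S leaf) (cut vert adj S' leaf') phi ->
  exists phi' : V -> V,
  [/\ forall x, vert x -> x \notin S ->
        [/\ vert (phi x), phi x \notin S' & phi' (phi x) = x],
      forall y, vert y -> y \notin S' ->
        [/\ vert (phi' y), phi' y \notin S & phi (phi' y) = y]
    & forall x y, vert x -> vert y -> x \notin S -> y \notin S ->
        adj (phi x) (phi y) = adj x y].
Proof.
case=> -[fV iV sV] mA mR.
pose K := rf_vert (cut vert adj S leaf); pose K' := rf_vert (cut vert adj S' leaf').
have KS x : vert x -> x \notin S -> x \in K.
  by move=> vx xS; rewrite /K /in_mem /= vx (negbTE xS).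
have K'S x : vert x -> x \notin S' -> x \in K'.
  by move=> vx xS; rewrite /K' /in_mem /= vx (negbTE xS).
have off x : vert x -> x \notin S -> vert (phi x) /\ phi x \notin S'.
  move=> vx xS; have := fV x (KS x vx xS); rewrite /= => /andP[-> nl].
  split=> //; apply: contra nl => pS; rewrite pS /=.
  have := mR _ (KS x vx xS); rewrite /= (negbTE xS) pS /= => ->.
  by [].
have /choice[phi' h'] : forall y, exists x, vert y -> y \notin S' ->
    [/\ vert x, x \notin S & phi x = y].
  move=> y; have [vy|] := boolP (vert y); last by exists y.
  have [yS|yS] := boolP (y \in S'); first by exists y.
  have [x Kx e] := sV y (K'S y vy yS); exists x => _ _.
  have := Kx; rewrite /= => /andP[vx nl]; split=> //.
  apply: contra nl => xS; rewrite xS /=.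
  have := mR _ Kx; rewrite /= e xS (negbTE yS) /= => <-.
  by [].
exists phi'; split.
- move=> x vx xS; have [vp pS] := off x vx xS; split=> //.
  have [v' S'' e] := h' _ vp pS.
  by apply: iV e; rewrite inE; exact: KS.
- by move=> y vy yS; have [] := h' y vy yS.
- move=> x y vx vy xS yS; have := mA _ _ (KS x vx xS) (KS y vy yS).
  have [vp pS] := off x vx xS; have [vp' pS'] := off y vy yS.
  by rewrite /= vx vy vp vp' (negbTE xS) (negbTE yS) (negbTE pS) (negbTE pS') /= !andbT.
Qed.

(** * Simple paths in acyclic graphs *)

Section SimplePaths.
Variables (V : choiceType) (adj : rel V).
Hypotheses (adjC : symmetric adj) (adjN : irreflexive adj) (adjA : acyclic adj).

(** An edge from the end of a simple path back to a vertex of it other than the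
    last but one would close a cycle. *)
Lemma acyclic_chord x p z : path adj x p -> uniq (x :: p) ->
  z \in x :: p -> adj (last x p) z ->
  exists2 p', p = rcons p' (last x p) & last x p' = z.
Proof.
move=> xp up zp az; case/splitPl: zp xp up az => p1 p2 e.
rewrite cat_path -cat_cons cat_uniq last_cat e => /andP[p1p p2p] /and3P[_ hp up2].
case: p2 p2p hp up2 => [|y [|w p2]] /=.
- by rewrite adjN.
- by move=> _ _ _ _; exists p1 => //; rewrite cats1.
rewrite -/(last w p2) => /and3P[azy ayw wp2] hp up2 alz.
have /adjA : ucycle adj [:: z, y, w & p2]; last by [].
rewrite /ucycle /= rcons_path azy ayw wp2 alz.
rewrite /= up2 andbT; apply/negP => zin; case/negP: hp.
have : has (mem (x :: p1)) [:: y, w & p2].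
  by apply/hasP; exists z => //; rewrite -e; exact: mem_last.
by [].
Qed.

(** Walks without backtracking never close up in an acyclic graph: a new
    vertex that was already present would give a chord. *)
Lemma simple_path_cat x p p2 : path adj x p -> uniq (x :: p) ->
    path adj (last x p) p2 -> uniq (last x p :: p2) ->
    (forall z p' p2', p = rcons p' (last x p) -> p2 = z :: p2' -> last x p' != z) ->
  uniq (x :: p ++ p2).
Proof.
elim: p2 p => [|z p2 IH] p xp up; first by rewrite cats0.
rewrite [path _ _ _]/= => /andP[az zp2] up2 nb; rewrite -cat_rcons.
have zp : z \notin x :: p.
  apply/negP => /acyclic_chord; case/(_ xp up az) => p' ep e.
  by move/eqP: (nb z p' p2 ep erefl).
apply: IH.
- by rewrite rcons_path xp.
- by rewrite -rcons_cons rcons_uniq zp.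
- by rewrite last_rcons.
- by rewrite last_rcons; case/andP: up2.
move=> w p' p2' /rcons_inj[<- _] e2; rewrite e2 in up2.
move: up2; rewrite /= inE; case/andP => + _.
by rewrite inE !negb_or => /and3P[_ +].
Qed.

(** If two such paths differed, then going along one and back along the
    other from where they part would be a closed walk without backtracking. *)
Lemma simple_path_inj x p p' : path adj x p -> path adj x p' ->
  uniq (x :: p) -> uniq (x :: p') -> last x p = last x p' -> p = p'.
Proof.
elim/last_ind: p p' => [|p y IH] p'.
  case: p' => //= y p' _ _ _ /andP[+ _] e.
  by rewrite e /= mem_last.
elim/last_ind: p' => [|p' y' _].
  by move=> _ _ + _; rewrite last_rcons /= => /andP[+ _] e; rewrite e mem_rcons inE eqxx.
rewrite !last_rcons => xpy xpy' up up' ey; subst y'.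
have := xpy; rewrite rcons_path => /andP[xp ay].
have := xpy'; rewrite rcons_path => /andP[xp' ay'].
have := up; rewrite -rcons_cons rcons_uniq => /andP[yp upx].
have := up'; rewrite -rcons_cons rcons_uniq => /andP[yp' upx'].
have [e|ne] := eqVneq (last x p) (last x p'); first by rewrite (IH p').
have revp : path adj y (rev (x :: p')).
  have := rev_path adj x (rcons p' y).
  rewrite last_rcons belast_rcons => ->.
  by rewrite (eq_path (e' := adj)) // => u v; exact: adjC.
have : uniq (x :: rcons p y ++ rev (x :: p')).
  apply: simple_path_cat => //; rewrite ?last_rcons //.
    by rewrite /= mem_rev rev_uniq yp'.
  move=> z q q' /rcons_inj[<-] e.
  apply: contraNneq ne => ->; have := congr1 (head x) e.
  by rewrite lastI rev_rcons /= => ->.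
by rewrite cons_uniq mem_cat mem_rev inE eqxx orbT.
Qed.

Lemma joined_simple x y : joined adj x y ->
  exists p, [/\ path adj x p, uniq (x :: p) & last x p = y].
Proof. by case=> p /shortenP[p' xp up _] <-; exists p'. Qed.

End SimplePaths.

(** * Coordinates on a planar forest *)

(** A root and the choices of children that lead from it to a vertex, the last
    choice first so that recursion goes towards the root. *)
Definition address (q : nat) : Type := bool * seq 'I_q.

Definition extend q (d : address q) (j : 'I_q) : address q := (d.1, j :: d.2).

Section ForestCoordinates.
Variables (q : nat) (W : choiceType) (A : rforest W) (le : rel W) (r1 r2 : W).
Hypotheses (hA : regular_rforest q A) (hle : planar A le).
Hypotheses (r12 : r1 != r2) (hr : rf_root A =1 pred2 r1 r2).

Let adj := rf_adj A.
Let adjC : symmetric adj. Proof. by case: hA => -[]. Qed.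
Let adjN : irreflexive adj. Proof. by case: hA => -[]. Qed.
Let adjA : acyclic adj. Proof. by case: hA. Qed.
Let adj_vert x y : adj x y -> rf_vert A x /\ rf_vert A y.
Proof. by case: hA => -[_ _ h _] _ _ _ /h/andP. Qed.
Let root_vert rho : rf_root A rho -> rf_vert A rho.
Proof. by case: hA => -[_ _ _ h] _ _ _ /h. Qed.

Let root_uniq rho rho' x : rf_root A rho -> rf_root A rho' ->
  joined adj rho x -> joined adj rho' x -> rho = rho'.
Proof.
move=> h h' j j'.
have vx : rf_vert A x.
  case: j => p; elim/last_ind: p => [|p y _] /=; first by move=> _ <-; exact: root_vert.
  by rewrite rcons_path last_rcons => /andP[_ /adj_vert[_ ?]] <-.
case: hA => _ _ /(_ x vx)[r0 [_ h0]] _.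
by rewrite -(h0 rho) // -(h0 rho').
Qed.

Lemma childP x y : child A x y <-> exists rho p,
  [/\ rf_root A rho, path adj rho (rcons p y), uniq (rho :: rcons p y) & last rho p = x].
Proof. by split; [move/asboolP | move=> h; apply/asboolP]. Qed.

Lemma child_adj x y : child A x y -> adj x y.
Proof. by case/childP => rho [p [_]]; rewrite rcons_path => /andP[_ +] _ <-. Qed.

Lemma child_inj x x' y : child A x y -> child A x' y -> x = x'.
Proof.
move=> /childP[rho [p [rr pp up <-]]] /childP[rho' [p' [rr' pp' up' <-]]].
have e : rho' = rho.
  by apply: (root_uniq (x := y)) => //; [exists (rcons p' y) | exists (rcons p y)];
     rewrite ?last_rcons.
subst rho'; have := simple_path_inj adjC adjN adjA pp pp' up up'.
by rewrite !last_rcons => /(_ erefl)/rcons_inj[->].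
Qed.

Lemma child_root x y : child A x y -> rf_root A y = false.
Proof.
move=> /childP[rho [p [rr pp up _]]]; apply/negP => ry.
have e : y = rho.
  apply: (root_uniq (x := y)) => //; first by exists [::].
  by exists (rcons p y); rewrite ?last_rcons.
by move: up; rewrite e /= mem_rcons inE eqxx.
Qed.

Lemma vert_root_path x : rf_vert A x ->
  exists rho p, [/\ rf_root A rho, path adj rho p, uniq (rho :: p) & last rho p = x].
Proof.
move=> vx; case: hA => _ _ /(_ x vx)[rho [[rr jr] _]] _.
by have [p [? ? ?]] := joined_simple jr; exists rho, p.
Qed.

Lemma adj_child x y : adj x y -> child A x y \/ child A y x.
Proof.
move=> axy; have [vx vy] := adj_vert axy.
have [rho [p [rr pp up lp]]] := vert_root_path vx.
have [yp|yp] := boolP (y \in rho :: p); last first.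
  left; apply/childP; exists rho, p; split=> //.
    by rewrite rcons_path pp lp.
  by rewrite -rcons_cons rcons_uniq yp.
have := acyclic_chord adjN adjA pp up yp; rewrite lp => /(_ axy)[p' ep e].
by right; apply/childP; exists rho, p'; rewrite -ep.
Qed.

Lemma child_asym x y : child A x y -> child A y x -> False.
Proof.
move=> /childP[rho [p [rr pp up lp]]] /childP[rho' [p' [rr' pp' up' lp']]].
have pp0 := pp; have up0 := up.
move: pp up; rewrite rcons_path -rcons_cons rcons_uniq => /andP[pp _] /andP[yp up].
have e : rho' = rho.
  by apply: (root_uniq (x := x)) => //; [exists (rcons p' x) | exists p];
     rewrite ?last_rcons.
subst rho'; have := simple_path_inj adjC adjN adjA pp pp' up up'.
rewrite last_rcons lp => /(_ erefl) ep; case/negP: yp.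
by rewrite ep -rcons_cons mem_rcons inE -lp' mem_last orbT.
Qed.

Lemma nonroot_has_parent x : rf_vert A x -> ~~ rf_root A x -> exists y, child A y x.
Proof.
move=> vx nr; have [rho [p [rr pp up lp]]] := vert_root_path vx.
elim/last_ind: p pp up lp => [|p y _] pp up lp; first by rewrite -lp /= rr in nr.
by exists (last rho p); apply/childP; exists rho, p; rewrite last_rcons in lp; rewrite -lp.
Qed.

Lemma child_vert x y : child A x y -> rf_vert A x /\ rf_vert A y.
Proof. by move/child_adj/adj_vert. Qed.

(** The neighbours of x are its children and, unless x is a root, its unique
    parent; the degree condition leaves q children, which are sorted by le. *)
Lemma children_list x : rf_vert A x -> exists s : seq W,
  [/\ size s = q, uniq s, s =i child A x &
      forall w j k, j < q -> k < q -> le (nth w s j) (nth w s k) = (j <= k)].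
Proof.
move=> vx; case: hA => _ _ _ /(_ x vx) hN.
have finN : finite_set [set y | rf_adj A x y] by apply/finite_setP; eexists; exact: hN.
pose N := fset_set [set y | rf_adj A x y].
have cN : #|` N| = if rf_root A x then q else q.+1 by exact: card_fset_set.
have NE y : (y \in N) = adj x y.
  by rewrite /N in_fset_set //; apply/idP/idP; rewrite inE.
pose C := [fset y in N | child A x y]%fset.
have CE y : (y \in C) = child A x y.
  rewrite !inE /= NE; case: (boolP (child A x y)) => [/child_adj ->|] //=.
  by rewrite andbF.
have cC : #|` C| = q.
  case rx: (rf_root A x) cN => cN.
    rewrite -cN; congr (#|` _ |); apply/fsetP => y; rewrite CE NE.
    apply/idP/idP => [/child_adj //|/adj_child[//|/child_root]].
    by rewrite rx.
  have [y yx] := nonroot_has_parent vx (negbT rx).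
  suff <- : (N `\ y)%fset = C.
    apply/eqP; rewrite -eqSS -cN [in X in _ == X](cardfsD1 y) NE adjC child_adj //.
  apply/fsetP => z; rewrite CE in_fsetD1 NE.
  apply/idP/idP => [/andP[zy]|cz].
    by case/adj_child => // /(child_inj yx) e; rewrite e eqxx in zy.
  rewrite child_adj // andbT; apply: contraPneq cz => -> /child_asym; exact.
have [lr la lt lo] := hle vx.
pose s := sort le (enum_fset C).
have allC (s' : seq W) : {subset s' <= child A x} -> all (child A x) s'.
  by move=> h; apply/allP => y /h.
have sE : s =i child A x by move=> y; rewrite mem_sort; exact: CE.
have us : uniq s by rewrite sort_uniq fset_uniq.
have ss : size s = q by rewrite size_sort -cC.
exists s; split=> // w j k jq kq.
have srt : sorted le s.
  by apply: (sort_sorted_in lo); apply: allC => y yC; change (child A x y); rewrite -CE.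
have mono j' k' : j' < q -> k' < q -> j' <= k' -> le (nth w s j') (nth w s k').
  move=> jq' kq'; apply: (sorted_leq_nth_in lt lr) => //; rewrite ?inE ?ss //.
  by apply: allC => y; rewrite sE.
apply/idP/idP => [ljk|]; last exact: mono.
case: leqP => // kj; have lkj := mono _ _ kq jq (ltnW kj).
have : nth w s j = nth w s k.
  by apply: la; rewrite ?ljk // -sE mem_nth ?ss.
by move/eqP; rewrite nth_uniq ?ss // => /eqP e; rewrite e ltnn in kj.
Qed.

(** The coordinates: iterating the choice of the j-th child from a root reaches
    every vertex once, as each vertex has a unique simple path from a root. *)
Lemma forest_coordinates : exists pos : address q -> W,
  [/\ injective pos, forall w, rf_vert A w <-> exists d, pos d = w,
      forall s : bool, pos (s, [::]) = if s then r2 else r1,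
      forall d w, child A (pos d) w <-> exists j, w = pos (extend d j)
    & forall d (j k : 'I_q), le (pos (extend d j)) (pos (extend d k)) = (j <= k)].
Proof.
have /choice[ch hch] : forall x, exists s : seq W, rf_vert A x ->
  [/\ size s = q, uniq s, s =i child A x &
      forall w j k, j < q -> k < q -> le (nth w s j) (nth w s k) = (j <= k)].
  move=> x; have [/children_list[s hs]|nv] := boolP (rf_vert A x); first by exists s.
  by exists [::].
pose posr (s : bool) := fix f (u : seq 'I_q) :=
  if u is j :: u' then nth r1 (ch (f u')) j else if s then r2 else r1.
pose pos (d : address q) := posr d.1 d.2.
have root_pos s : rf_root A (pos (s, [::])).
  by rewrite hr /=; case: s; rewrite /pos /= eqxx ?orbT.
have vpos d : rf_vert A (pos d).
  case: d => s; elim=> [|j u IH]; first exact: root_vert.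
  have [ss _ sE _] := hch _ IH.
  have : child A (pos (s, u)) (pos (s, j :: u)) by rewrite -[child _ _ _]sE mem_nth ?ss.
  by case/child_vert.
have cpos d j : child A (pos d) (pos (extend d j)).
  by have [ss _ sE _] := hch _ (vpos d); rewrite -[child _ _ _]sE mem_nth ?ss.
have cposP d w : child A (pos d) w <-> exists j, w = pos (extend d j).
  split=> [|[j ->] //]; have [ss _ sE _] := hch _ (vpos d); rewrite -[child _ _ _]sE.
  move=> wi; have := wi; rewrite -index_mem ss => iq; exists (Ordinal iq).
  by rewrite /pos /= nth_index.
exists pos; split=> //.
- case=> s u [s' u']; elim: u u' => [|j u IH] [|j' u'].
  + rewrite /pos /=; case: s; case: s' => // e; by move: r12; rewrite e eqxx.
  + move=> e; have := child_root (cpos (s', u') j').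
    by rewrite /extend /= -e root_pos.
  + move=> e; have := child_root (cpos (s, u) j).
    by rewrite /extend /= e root_pos.
  move=> e; have := cpos (s', u') j'; rewrite /extend /= -e => /(child_inj (cpos (s, u) j)).
  move=> /IH[? ?]; subst s' u'; have [ss us _ _] := hch _ (vpos (s, u)).
  have /eqP := e; rewrite /pos /= nth_uniq ?ss // => /eqP e'.
  by rewrite (val_inj e').
- move=> w; split=> [vw|[d <-] //].
  have [rho [p [rr pp up lp]]] := vert_root_path vw.
  elim/last_ind: p w {vw} pp up lp => [|p y IH] w pp up lp.
    rewrite -lp /=; move: rr; rewrite hr => /orP[]/eqP ->; first by exists (false, [::]).
    by exists (true, [::]).
  have [|||d ed] := IH (last rho p) => //.
  - by move: pp; rewrite rcons_path => /andP[].
  - by move: up; rewrite -rcons_cons rcons_uniq => /andP[].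
  have /cposP[j ->] : child A (pos d) w.
    by rewrite ed; apply/childP; exists rho, p; rewrite -lp last_rcons.
  by exists (extend d j).
- move=> d j k; have [_ _ _ h] := hch _ (vpos d); exact: h.
Qed.

End ForestCoordinates.

(** * The regular tree in coordinates *)

Lemma fconnected_to (V : choiceType) (adj : rel V) (S : {fset V}) (o : V) :
    symmetric adj -> o \in S ->
    (forall x, x \in S -> exists p, [/\ path adj x p, last x p = o & {subset p <= S}]) ->
  fconnected adj S.
Proof.
move=> adjC oS h x y xS yS.
have [p [xp lp pS]] := h x xS; have [p' [yp' lp' p'S]] := h y yS.
exists (p ++ rev (belast y p')); split.
- rewrite cat_path xp lp -lp' rev_path.
  by rewrite (eq_path (e' := adj)) // => u v; exact: adjC.
- rewrite last_cat lp; case: p' lp' {yp' p'S} => [<- //|z p' _].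
  by rewrite /= rev_cons last_rcons.
- move=> z; rewrite mem_cat mem_rev => /orP[/pS //|/mem_belast].
  by rewrite inE => /predU1P[-> //|/p'S].
Qed.

Lemma injective_onto (I : finType) (T : Type) (g h : I -> T) :
  injective g -> (forall i, exists j, g i = h j) -> forall j, exists i, h j = g i.
Proof.
move=> gi /choice[k hk] j.
have ki : injective k by move=> a b e; apply: gi; rewrite !hk e.
by have /codomP[i ->] := injF_onto ki j; exists i.
Qed.

(** Each of the two roots, the end points of e, is declared the parent of the
    other. Adjacency in T then means that one vertex is the parent of the other,
    without a special case for e. *)
Definition up_address q (d : address q) : address q :=
  if d.2 is _ :: u then (d.1, u) else (~~ d.1, [::]).

Section CoordinatizedTree.
Variables (q : nat) (V : choiceType) (adj : rel V).
Hypothesis adjC : symmetric adj.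
Hypothesis degE : forall x, ([set y | adj x y] #= `I_q.+1)%card.
Variables (pos : address q -> V) (crd : V -> address q).
Hypotheses (posK : cancel pos crd) (crdK : cancel crd pos).
Hypothesis adj_pos : forall d d',
  adj (pos d) (pos d') = (d == up_address d') || (d' == up_address d).
Implicit Types (x y z : V) (j k : 'I_q) (n : nat).

Definition kid x j := pos (extend (crd x) j).
Definition up x := pos (up_address (crd x)).
Definition dep x := size (crd x).2.
Definition base := pos (false, [::]).

Lemma up_kid x j : up (kid x j) = x.
Proof. by rewrite /up /kid posK /=; case: (crd x) (crdK x). Qed.

Lemma dep_kid x j : dep (kid x j) = (dep x).+1.
Proof. by rewrite /dep /kid posK. Qed.

Lemma kid_inj x : injective (kid x).
Proof. by move=> j k /(can_inj posK)[]. Qed.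

Lemma dep_up x : dep (up x) = (dep x).-1.
Proof. by rewrite /dep /up posK; case: (crd x) => s []. Qed.

Lemma kid_of_up x : 0 < dep x -> exists j, x = kid (up x) j.
Proof.
rewrite /dep /kid /up posK -{2}[x]crdK; case: (crd x) => s [|j u] //= _.
by exists j.
Qed.

Lemma adj_up x y : adj x y = (x == up y) || (y == up x).
Proof.
by rewrite -{1}[x]crdK -{1}[y]crdK adj_pos !(can2_eq crdK posK).
Qed.

Lemma up_up x : dep x = 0 -> up (up x) = x.
Proof.
rewrite -[X in _ -> _ = X]crdK /up /dep posK; case: (crd x) => s [|] //= _.
by rewrite /up_address /= negbK.
Qed.

Lemma dep0_base x : dep x = 0 -> x = base \/ up x = base.
Proof.
rewrite -{2}(crdK x) /dep /up /base; case: (crd x) => [[] []] //= _; by [right | left].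
Qed.

Definition nb x (o : option 'I_q) := if o is Some j then kid x j else up x.

Lemma adjP x y : reflect (exists o, y = nb x o) (adj x y).
Proof.
rewrite adj_up; apply: (iffP orP) => [[/eqP e|/eqP ->]|[[j|] -> /=]].
- have [y0|yn] := posnP (dep y); first by exists None => /=; rewrite e up_up.
  by have [j ej] := kid_of_up yn; exists (Some j); rewrite e.
- by exists None.
- by rewrite up_kid eqxx; left.
- by rewrite eqxx; right.
Qed.

Lemma kid_neq_up x j : kid x j <> up x.
Proof. by move=> /(congr1 dep); rewrite dep_kid dep_up; lia. Qed.

Lemma nb_inj x : injective (nb x).
Proof.
move=> [j|] [k|] //= e; first by rewrite (kid_inj e).
  by case: (kid_neq_up e).
by case: (@kid_neq_up x k).
Qed.

Fixpoint ball n : {fset V} :=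
  if n is m.+1 then
    (ball m `|` \bigcup_(x <- enum_fset (ball m)) [fset kid x j | j in 'I_q])%fset
  else [fset base; up base]%fset.

Lemma in_ball n x : (x \in ball n) = (dep x <= n).
Proof.
elim: n x => [|n IH] x /=.
  rewrite !inE leqn0; apply/idP/eqP => [/orP[]/eqP->|/[dup] x0 /dep0_base[->|<-]].
  - by rewrite /dep posK.
  - by rewrite dep_up /dep posK.
  - by rewrite eqxx.
  - by rewrite up_up // eqxx orbT.
rewrite inE IH; apply/orP/idP => [[|/bigfcupP[y /andP[]]]|].
- exact: leqW.
- by move=> + _ /imfsetP[j _ ->]; rewrite IH dep_kid.
rewrite leq_eqVlt => /predU1P[xn|]; [right | by left].
have [|j ej] := @kid_of_up x; first by rewrite xn.
apply/bigfcupP; exists (up x); last by apply/imfsetP; exists j.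
by rewrite andbT IH dep_up xn.
Qed.

Lemma up_eqE x y : up x = y -> 0 < dep x -> exists j, x = kid y j.
Proof. by move=> <- /kid_of_up. Qed.

(** * Isomorphisms from the complement of a ball *)

(** F is the ball-like side of the target: the complement of the image of the
    vertices of depth greater than n. It contains the edge e by the third
    condition; the images of the vertices of depth n will be its leaves. *)
Definition complement_iso (n : nat) (F : {fset V}) (phi : V -> V) : Prop :=
  [/\ forall x y, n <= dep x -> n <= dep y -> phi x = phi y -> x = y,
      forall x y, n <= dep x -> n <= dep y -> adj (phi x) (phi y) = adj x y,
      forall x, n < dep x -> 0 < dep (phi x)
    & forall y, y \notin F <-> exists2 x, n < dep x & phi x = y].

Section ComplementIso.
Variables (n : nat) (F : {fset V}) (phi : V -> V).
Hypothesis hphi : complement_iso n F phi.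

Let phi_inj x y : n <= dep x -> n <= dep y -> phi x = phi y -> x = y.
Proof. by case: hphi => + _ _ _; exact. Qed.
Let phi_adj x y : n <= dep x -> n <= dep y -> adj (phi x) (phi y) = adj x y.
Proof. by case: hphi => _ + _ _; exact. Qed.
Let dep_phi x : n < dep x -> 0 < dep (phi x).
Proof. by case: hphi => _ _ + _; exact. Qed.
Let notinF y : y \notin F <-> exists2 x, n < dep x & phi x = y.
Proof. by case: hphi. Qed.

Let dep_nb x o : n < dep x -> n <= dep (nb x o).
Proof. by case: o => [j|] /=; rewrite ?dep_kid ?dep_up; lia. Qed.

(** Beyond depth n all q + 1 neighbours are in the domain, and their images are
    as many neighbours of the image. *)
Lemma phi_nb_onto x o : n < dep x -> exists o', nb (phi x) o = phi (nb x o').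
Proof.
move=> nx; apply: (@injective_onto _ _ (fun o => phi (nb x o)) (nb (phi x))).
  by move=> o1 o2 /phi_inj e; apply: (@nb_inj x); apply: e; exact: dep_nb.
move=> o1; have /adjP[o2 e] : adj (phi x) (phi (nb x o1)); last by exists o2.
by rewrite phi_adj ?dep_nb ?(ltnW nx) //; apply/adjP; exists o1.
Qed.

(** If phi reversed one edge pointing away from e, it would reverse an edge
    below that one, whose image is nearer to e; this descent would reach e, but
    e is not in the image of the vertices of depth greater than n. *)
Lemma phi_kid_neq_up x j : n <= dep x -> phi (kid x j) <> up (phi x).
Proof.
move: {2}(dep (phi x)).+1 (ltnSn (dep (phi x))) => m.
elim: m x j => // m IH x j dm nx e.
have nk : n < dep (kid x j) by rewrite dep_kid.
have /(congr1 dep) ed := e; rewrite dep_up in ed.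
have dk := dep_phi nk.
have [[k|] e'] := phi_nb_onto None nk; last first.
  move: e' => /=; rewrite up_kid => /(congr1 dep); rewrite dep_up; lia.
by apply: IH (esym e'); [lia | exact: ltnW].
Qed.

Lemma phi_kid x j : n <= dep x -> exists k, phi (kid x j) = kid (phi x) k.
Proof.
move=> nx; have : adj (phi x) (phi (kid x j)).
  by rewrite phi_adj // ?dep_kid ?leqW //; apply/adjP; exists (Some j).
by move=> /adjP[[k|] e]; [exists k | case: (phi_kid_neq_up nx e)].
Qed.

Lemma phi_kid_onto x k : n <= dep x -> exists j, kid (phi x) k = phi (kid x j).
Proof.
move=> nx; apply: (@injective_onto _ _ (fun j => phi (kid x j)) (kid (phi x))).
  by move=> j1 j2 /phi_inj e; apply: (@kid_inj x); apply: e; rewrite dep_kid leqW.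
by move=> j; exact: phi_kid.
Qed.

Lemma in_F_phi x : n <= dep x -> (phi x \in F) = (dep x == n).
Proof.
rewrite leq_eqVlt => /predU1P[nx|nx].
  rewrite -nx eqxx; apply/negPn/negP => /notinF[y ny /phi_inj e].
  have {}e : y = x by apply: e; [exact: ltnW | rewrite nx].
  by move: ny; rewrite e -nx ltnn.
by rewrite gtn_eqF //; apply/negbTE/notinF; exists x.
Qed.

Lemma in_F_root y : dep y = 0 -> y \in F.
Proof. by move=> y0; apply/negPn/negP => /notinF[x /dep_phi + e]; rewrite e y0. Qed.

(** A vertex outside F has all its children outside F, by [phi_kid_onto]. *)
Lemma in_F_up y : y \in F -> up y \in F.
Proof.
move=> yF; apply/negPn/negP => /notinF[x nx e].
have [y0|yn] := posnP (dep y).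
  by have := dep_phi nx; rewrite e dep_up y0.
have [k ek] := up_eqE (esym e) yn.
have [j ej] := phi_kid_onto k (ltnW nx).
by move: yF; rewrite ek ej in_F_phi ?dep_kid; lia.
Qed.

Definition image_leaf y := exists2 x, dep x = n & phi x = y.

Lemma image_leaf_kid y k : image_leaf y -> kid y k \notin F.
Proof.
case=> x nx <-; have [|j ->] := @phi_kid_onto x k; first by rewrite nx.
by apply/notinF; exists (kid x j); rewrite ?dep_kid ?nx.
Qed.

Lemma inner_kid y k : y \in F -> ~ image_leaf y -> kid y k \in F.
Proof.
move=> yF nl; apply/negPn/negP => /notinF[x nx e].
have [j ej] := @kid_of_up x (leq_ltn_trans (leq0n n) nx).
have nu : n <= dep (up x) by rewrite dep_up; lia.
have [k' ek] := @phi_kid (up x) j nu; rewrite -ej in ek.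
have ey : y = phi (up x) by rewrite -[y](up_kid y k) -e ek up_kid.
by apply: nl; exists (up x) => //; apply/eqP; rewrite -in_F_phi -?ey.
Qed.

Lemma image_leaf_in y : image_leaf y -> y \in F.
Proof. by case=> x nx <-; rewrite in_F_phi nx. Qed.

Lemma subdegree_leaf y : image_leaf y -> subdegree adj F y = 1.
Proof.
move=> ly; rewrite /subdegree; apply/eqP/cardfs1P; exists (up y).
apply/fsetP => z; rewrite !inE /=; apply/idP/eqP => [/andP[zF /adjP[[k|] //]]|->].
  by move=> ez; have := image_leaf_kid k ly; rewrite -[kid y k]ez zF.
by rewrite in_F_up ?image_leaf_in //; apply/adjP; exists None.
Qed.

Lemma subdegree_inner y : y \in F -> ~ image_leaf y -> subdegree adj F y = q.+1.
Proof.
move=> yF nl; rewrite -(card_fset_set (degE y)); congr (#|` _|).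
have fin : finite_set [set z | adj y z] by apply/finite_setP; exists q.+1.
apply/fsetP => z; rewrite in_fset_set // !inE /=; apply/andP/idP => [[_ ?]|].
  by rewrite inE.
rewrite inE => /= ayz; split=> //; case/adjP: ayz => -[k|] -> /=.
  exact: inner_kid.
exact: in_F_up.
Qed.

(** F is connected because it is closed under parents and contains e. *)
Lemma complement_subtree : finite_regular_subtree q adj F.
Proof.
have bF : base \in F by apply: in_F_root; rewrite /dep posK.
split; first by apply/fset0Pn; exists base.
- apply: (fconnected_to adjC bF) => x.
  move: {2}(dep x) (erefl (dep x)) => m; elim: m x => [|m IH] x xm xF.
    case: (dep0_base xm) => [->|ux]; first by exists [::].
    exists [:: base]; split=> //=; first by rewrite andbT -ux; apply/adjP; exists None.
    by move=> z; rewrite inE => /eqP->.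
  have [|p [pp lp pF]] := IH (up x) _ (in_F_up xF); first by rewrite dep_up xm.
  exists (up x :: p); split=> //=.
    by rewrite pp andbT; apply/adjP; exists None.
  by move=> z; rewrite inE => /predU1P[->|/pF //]; exact: in_F_up.
- move=> x xF; have [l|nl] := pselect (image_leaf x); first by left; exact: subdegree_leaf.
  by right; exact: subdegree_inner.
Qed.

Lemma image_deepP y : (exists2 x, n <= dep x & phi x = y) <-> y \notin F \/ image_leaf y.
Proof.
split=> [[x]|[/notinF[x /ltnW nx <-]|[x nx <-]]]; last 2 first.
- by exists x.
- by exists x; rewrite ?nx.
rewrite leq_eqVlt => /predU1P[nx e|nx e]; [right | left].
  by exists x.
by apply/notinF; exists x.
Qed.

End ComplementIso.

Hypothesis q_gt0 : 0 < q.

(** * Complement forests *)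

(** The complement of F, both in T and in the planar forest, looks like the
    complement of the ball of radius n under a suitable h. With this description
    the required isomorphisms of forests come from one lemma. *)
Definition deep_model (n : nat) (W : choiceType) (B : rforest W) (h : V -> W) : Prop :=
  [/\ forall w, rf_vert B w <-> exists2 x, n <= dep x & h x = w,
      forall x y, n <= dep x -> n <= dep y -> h x = h y -> x = y,
      forall x y, n <= dep x -> n <= dep y -> rf_adj B (h x) (h y) = adj x y,
      forall x, n <= dep x -> rf_root B (h x) = (dep x == n)
    & forall w w', rf_adj B w w' -> rf_vert B w /\ rf_vert B w'].

Lemma deep_model_iso n (W : choiceType) (B1 B2 : rforest W)
    (h1 h2 : V -> W) (phi : W -> W) :
    deep_model n B1 h1 -> deep_model n B2 h2 ->
    (forall x, n <= dep x -> phi (h1 x) = h2 x) ->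
  rforest_iso B1 B2 phi.
Proof.
move=> [v1 i1 a1 ro1 _] [v2 i2 a2 ro2 _] e; split.
- split=> [w /v1[x nx <-]|w w'|w /v2[x nx <-]] /=.
  + by apply/v2; exists x => //; rewrite e.
  + rewrite !inE => /v1[x nx <-] /v1[y ny <-]; rewrite !e // => /i2 -> //.
  + by exists (h1 x); [apply/v1; exists x | exact: e].
- by move=> w w' /v1[x nx <-] /v1[y ny <-]; rewrite !e // a1 ?a2.
- by move=> w /v1[x nx <-]; rewrite e // ro1 ?ro2.
Qed.

(** A simple path from a root cannot go up at first, roots being the vertices of
    least depth, and cannot go up later without turning back. *)
Lemma deep_model_child n (W : choiceType) (B : rforest W) (h : V -> W) w w' :
    0 < n -> deep_model n B h -> child B w w' ->
  exists x j, [/\ n <= dep x, w = h x & w' = h (kid x j)].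
Proof.
move=> n0 [vB hi ha hroot hv] /asboolP[rho [p [rr pp up <-]]].
elim/last_ind: p w' pp up => [|p u IH] w'.
  rewrite /= andbT => arw _; have [/vB[x nx ex] /vB[y ny ey]] := hv _ _ arw.
  subst rho w'; rewrite ha // in arw; rewrite hroot // in rr.
  case/adjP: arw => -[j|] /= ey; first by exists x, j; rewrite ey.
  by move: ny rr; rewrite ey dep_up => + /eqP; lia.
rewrite rcons_path last_rcons => /andP[pp auw] up.
have := up; rewrite -rcons_cons rcons_uniq => /andP[wp up'].
have [x [j [nx ex eu]]] := IH u pp up'.
have [_ /vB[y ny ey]] := hv _ _ auw; subst u w'.
have nk : n <= dep (kid x j) by rewrite dep_kid leqW.
rewrite ha // in auw; case/adjP: auw => -[k|] /= ey.
  by exists (kid x j), k; rewrite ey.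
move: wp; rewrite ey up_kid -ex -rcons_cons mem_rcons inE.
by rewrite mem_last orbT.
Qed.

Lemma tree_minus_model n F phi : 0 < n -> complement_iso n F phi ->
  deep_model n (tree_minus adj F) phi.
Proof.
move=> n0 hphi; have [pi pa _ pF] := hphi.
have leafP y : y \in F -> (subdegree adj F y == 1) = `[< image_leaf n phi y >].
  move=> yF; case: asboolP => [l|nl]; first by rewrite (subdegree_leaf hphi).
  by rewrite (subdegree_inner hphi) //; apply/negbTE; rewrite eqSS -lt0n.
have vE y : rf_vert (tree_minus adj F) y <-> exists2 x, n <= dep x & phi x = y.
  rewrite (image_deepP hphi) /=.
  case: (boolP (y \in F)) => yF /=; last by split=> // _; left.
  by rewrite negbK leafP //; split=> [/asboolP|[//|/asboolP]]; [right|].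
split=> //.
- move=> x y nx ny; have vx := (vE (phi x)).2 (ex_intro2 _ _ x nx erefl).
  have vy := (vE (phi y)).2 (ex_intro2 _ _ y ny erefl).
  rewrite /= in vx vy *; rewrite vx vy /= pa // !(in_F_phi hphi) //.
  case axy: (adj x y) => //=; apply/negP => /andP[/eqP xn /eqP yn].
  case/adjP: axy => -[j|] /(congr1 dep) /=; rewrite ?dep_kid ?dep_up; lia.
- move=> x nx /=; rewrite (in_F_phi hphi) //; case: eqP => //= xn.
  rewrite leafP ?(in_F_phi hphi) ?xn //; apply/asboolP; by exists x.
- by move=> w w' /and4P[].
Qed.

Lemma complement_iso_ball n : complement_iso n (ball n) id.
Proof.
split=> //; first by move=> x; exact: leq_ltn_trans.
by move=> y; rewrite in_ball -ltnNge; split=> [|[x nx <-] //]; exists y.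
Qed.

Lemma dep_bound (S : {fset V}) : exists n, forall x, x \in S -> dep x < n.
Proof.
have [n h] : exists n, forall x, x \in enum_fset S -> dep x < n; last by exists n.
elim: (enum_fset S) => [|x s [n IH]]; first by exists 0.
exists (maxn n (dep x).+1) => y; rewrite inE leq_max => /predU1P[->|/IH ->] //.
by rewrite ltnSn orbT.
Qed.

(** The ball must contain S, and for e to lie in F it must also contain the
    preimages of the end points of e. *)
Lemma spheromorphism_complement (f : Defs.bij (ends adj)) : spheromorphism f ->
  exists n F phi phi', [/\ 0 < n, complement_iso n F phi,
    forall x, n <= dep x -> phi' (phi x) = x
    & forall E r, end_rays E r -> (forall m, n <= dep (r m)) ->
        end_rays (f E) (phi \o r)].
Proof.
case=> S [S' [phi [phi' [h1 h2 h3 h4]]]].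
have [m hm] := dep_bound (S `|` [fset phi' base; phi' (up base)])%fset.
have [n en] : exists n, n = m.+1 by exists m.+1.
have offS x : n <= dep x -> x \notin S.
  by move=> nx; apply/negP => xS; have := hm x; rewrite inE xS; lia.
pose F := (S' `|` [fset phi x | x in ball n `\` S])%fset.
exists n, F, phi, phi'; split=> //; [by rewrite en | | |]; last 2 first.
- by move=> x /offS/h1[].
- by move=> E r Er nr; apply: h4 => // k; exact: offS.
split.
- by move=> x y /offS/h1[_ {2}<-] /offS/h1[_ {2}<-] ->.
- by move=> x y /offS xS /offS yS; exact: h3.
- move=> x nx; rewrite lt0n; apply/eqP => p0.
  have [_ e] := h1 _ (offS _ (ltnW nx)).
  have : dep x < m.
    apply: hm; rewrite -{}e; case: (dep0_base p0) => [->|<-];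
    by rewrite ?up_up // !inE eqxx ?orbT.
  lia.
move=> y; rewrite inE negb_or; split=> [/andP[yS yB]|[x nx <-]].
  have [xS e] := h2 _ yS; exists (phi' y) => //.
  rewrite ltnNge; apply: contra yB => xn.
  by apply/imfsetP; exists (phi' y); rewrite ?e //= inE xS in_ball.
have [pS e] := h1 _ (offS _ (ltnW nx)); rewrite pS /=.
apply/imfsetP => -[z /=]; rewrite inE in_ball => /andP[zS zn] ez.
have [_ e'] := h1 _ zS; move: nx; rewrite -e ez e'; lia.
Qed.

(** An isomorphism of complement forests restricts to one off the finite
    subtrees; conversely, the ball and F are finite regular subtrees. *)
Lemma Neretin_spheromorphism f : Neretin adj q f <-> spheromorphism f.
Proof.
split=> [[F1 [F2 [phi [_ _ iso ind]]]]|/spheromorphism_complement].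
  have [phi' [h1 h2 h3]] := cut_iso_off iso.
  exists F1, F2, phi, phi'; split.
  - by move=> x /(h1 x isT)[].
  - by move=> y /(h2 y isT)[].
  - by move=> x y; exact: h3.
  - move=> E r Er rF; apply: ind => //; have [ri ra] := end_rays_is_ray Er.
    by split=> // n; rewrite /= ra (negbTE (rF n)) (negbTE (rF n.+1)).
case=> n [F [phi [_ [n0 hphi _ ind]]]].
have hb := complement_iso_ball n.
exists (ball n), F, phi; split.
- exact: complement_subtree hb.
- exact: complement_subtree hphi.
- by apply: (deep_model_iso (tree_minus_model n0 hb) (tree_minus_model n0 hphi)).
move=> E r Er [ri ra]; apply: ind => // m.
have [vb _ _ _ hv] := tree_minus_model n0 hb.
by have [/vb[x nx <-] _] := hv _ _ (ra m).
Qed.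


(** * Straightening an isomorphism by an automorphism *)

Section Relabelling.
Variables (n : nat) (F : {fset V}) (phi phi' : V -> V).
Hypotheses (hphi : complement_iso n F phi)
  (phiK : forall x, n <= dep x -> phi' (phi x) = x).

(** The identity on the ball; below it, the j-th child of x is sent to the child
    of the image of x whose phi-image is the j-th one. *)
Fixpoint relabel_address (s : bool) (u : seq 'I_q) : V :=
  if u is j :: u' then
    if n <= size u' then phi' (kid (phi (relabel_address s u')) j) else pos (s, u)
  else pos (s, [::]).

Definition relabel x := relabel_address (crd x).1 (crd x).2.

Lemma relabel_low x : dep x <= n -> relabel x = x.
Proof.
rewrite -{3}[x]crdK /dep /relabel; case: (crd x) => s [|j u] //= un.
by rewrite leqNgt un.
Qed.

Lemma relabel_kid_deep x j : n <= dep x ->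
  relabel (kid x j) = phi' (kid (phi (relabel x)) j).
Proof. by rewrite /relabel [in crd (kid _ _)]/kid posK /= -/(dep x) => ->. Qed.

Lemma dep_relabel x : dep (relabel x) = dep x.
Proof.
move: {2}(dep x) (erefl (dep x)) => m; elim: m x => [|m IH] x xm.
  by rewrite relabel_low xm.
have [xn|nx] := leqP (dep x) n; first by rewrite relabel_low.
have [|j ej] := @kid_of_up x; first by rewrite xm.
have um : dep (up x) = m by rewrite dep_up xm.
have nu : n <= dep (up x) by rewrite um -ltnS -xm.
have [|k ek] := phi_kid_onto hphi j (_ : n <= dep (relabel (up x))).
  by rewrite IH.
by rewrite ej relabel_kid_deep // ek phiK !dep_kid IH // leqW.
Qed.

Lemma relabel_kid x j : exists k, relabel (kid x j) = kid (relabel x) k.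
Proof.
have [nx|xn] := leqP n (dep x); last first.
  by exists j; rewrite !relabel_low ?dep_kid // ltnW.
have nr : n <= dep (relabel x) by rewrite dep_relabel.
have [k ek] := phi_kid_onto hphi j nr; exists k.
by rewrite relabel_kid_deep // ek phiK // dep_kid leqW.
Qed.

(** The purpose of the relabelling: phi \o relabel preserves the numbering of
    children, hence their order. *)
Lemma phi_relabel_kid x j : n <= dep x ->
  phi (relabel (kid x j)) = kid (phi (relabel x)) j.
Proof.
move=> nx; have nr : n <= dep (relabel x) by rewrite dep_relabel.
have [k ek] := phi_kid_onto hphi j nr.
by rewrite relabel_kid_deep // ek phiK // dep_kid leqW.
Qed.

Lemma relabel_up x : relabel (up x) = up (relabel x).
Proof.
have [x0|/kid_of_up[j ->]] := posnP (dep x).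
  by rewrite !relabel_low // ?dep_up x0.
by have [k ->] := relabel_kid (up x) j; rewrite !up_kid.
Qed.

Lemma relabel_inj : injective relabel.
Proof.
move=> x; move: {2}(dep x) (erefl (dep x)) => m; elim: m x => [|m IH] x xm y e.
  have ey : dep y = dep x by rewrite -dep_relabel -e dep_relabel.
  by move: e; rewrite !relabel_low // ?ey xm.
have ey : dep y = dep x by rewrite -dep_relabel -e dep_relabel.
have [xn|nx] := leqP (dep x) n; first by move: e; rewrite !relabel_low ?ey.
have [|j ej] := @kid_of_up x; first by rewrite xm.
have [|k ek] := @kid_of_up y; first by rewrite ey xm.
have eu : up x = up y by apply: IH; rewrite ?dep_up ?xm // !relabel_up e.
have nu : n <= dep (up x) by rewrite dep_up xm -ltnS -xm.
have := congr1 phi e; rewrite {1}ej {1}ek -eu !phi_relabel_kid // => /kid_inj ejk.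
by rewrite ej ek -eu ejk.
Qed.

Lemma relabel_onto y : exists x, relabel x = y.
Proof.
move: {2}(dep y) (erefl (dep y)) => m; elim: m y => [|m IH] y ym.
  by exists y; rewrite relabel_low // ym.
have [yn|ny] := leqP (dep y) n; first by exists y; rewrite relabel_low.
have [|k ek] := @kid_of_up y; first by rewrite ym.
have um : dep (up y) = m by rewrite dep_up ym.
have [x ex] := IH (up y) um; rewrite -ex in ek.
have nx : n <= dep x by rewrite -dep_relabel ex um -ltnS -ym.
have [|j ej] := phi_kid hphi k (_ : n <= dep (relabel x)); first by rewrite dep_relabel.
exists (kid x j); have [pi _ _ _] := hphi; apply: pi.
- by rewrite dep_relabel dep_kid leqW.
- exact: ltnW.
- by rewrite phi_relabel_kid // -ej -ek.
Qed.

Lemma relabel_adj x y : adj (relabel x) (relabel y) = adj x y.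
Proof. by rewrite !adj_up -!relabel_up !(inj_eq relabel_inj). Qed.

(** Parent and child have different colours, and [relabel] commutes with taking
    parents and fixes the two roots. *)
Lemma relabel_color (c : V -> bool) : two_coloring adj c ->
  forall x, c (relabel x) = c x.
Proof.
move=> hc x; move: {2}(dep x) (erefl (dep x)) => m; elim: m x => [|m IH] x xm.
  by rewrite relabel_low // xm.
have [|j ej] := @kid_of_up x; first by rewrite xm.
have uc y : c y = ~~ c (up y).
  have /hc : adj y (up y) by apply/adjP; exists None.
  by case: (c y); case: (c _).
by rewrite uc -relabel_up IH ?dep_up ?xm // -uc.
Qed.

Lemma complement_iso_relabel : complement_iso n F (phi \o relabel).
Proof.
have [pi pa pd pF] := hphi; split=> /=.
- by move=> x y nx ny /pi e; apply: relabel_inj; apply: e; rewrite dep_relabel.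
- by move=> x y nx ny; rewrite pa ?dep_relabel // relabel_adj.
- by move=> x nx; apply: pd; rewrite dep_relabel.
move=> y; rewrite pF; split=> -[x nx <-]; last by exists (relabel x); rewrite ?dep_relabel.
by have [z ez] := relabel_onto x; exists z; rewrite ?ez // -[dep z]dep_relabel ez.
Qed.

End Relabelling.

(** * The Higman-Thompson group *)

Section PlanarModel.
Variables (W : choiceType) (A : rforest W) (le : rel W) (r1 r2 : W).
Variables (i : W -> V) (inA : V -> W).
Hypotheses (inAK : cancel inA i)
  (vertA : forall w, rf_vert A w <-> exists x, inA x = w)
  (childA : forall x w, child A (inA x) w <-> exists j, w = inA (kid x j))
  (leA : forall x j k, le (inA (kid x j)) (inA (kid x k)) = (j <= k))
  (adjA : forall x y, rf_adj A (inA x) (inA y) = adj x y && (0 < dep x + dep y))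
  (adj_vertA : forall w w', rf_adj A w w' -> rf_vert A w /\ rf_vert A w')
  (inA_root : forall s : bool, inA (pos (s, [::])) = if s then r2 else r1).

(** The part of F in one of the two planar trees. Intersecting with a side gives
    a subtree because F is closed under parents. *)
Definition planar_part (F : {fset V}) (s : bool) : {fset W} :=
  [fset inA x | x in [fset x in F | (crd x).1 == s]]%fset.

Lemma in_planar_part F s x : (inA x \in planar_part F s) = (x \in F) && ((crd x).1 == s).
Proof. by rewrite mem_imfset /= ?inE //; exact: can_inj inAK. Qed.

Lemma planar_partP F s w : w \in planar_part F s ->
  exists x, [/\ w = inA x, x \in F & (crd x).1 = s].
Proof. by case/imfsetP => x /=; rewrite !inE => /andP[xF /eqP xs] ->; exists x. Qed.

Lemma side_kid x j : (crd (kid x j)).1 = (crd x).1.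
Proof. by rewrite /kid posK. Qed.

Lemma planar_part_subtree n F phi s : complement_iso n F phi ->
  rooted_subtree A (if s then r2 else r1) (planar_part F s).
Proof.
move=> hphi; have oS : inA (pos (s, [::])) \in planar_part F s.
  by rewrite in_planar_part posK eqxx andbT; apply: (in_F_root hphi); rewrite /dep posK.
rewrite -inA_root; split=> //.
- apply: (fconnected_to _ oS).
    move=> w w'; apply/idP/idP => h; have [/vertA[x ex] /vertA[y ey]] := adj_vertA h;
    by move: h; rewrite -ex -ey !adjA adjC addnC.
  move=> _ /planar_partP[x [-> xF xs]].
  move: {2}(dep x) (erefl (dep x)) => m; elim: m x xF xs => [|m IH] x xF xs xm.
    exists [::]; split=> //=; congr inA; rewrite -[x]crdK -xs.
    by move: xm; rewrite /dep; case: (crd x) => t [].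
  have [|j ej] := @kid_of_up x; first by rewrite xm.
  have uF : up x \in F := in_F_up hphi xF.
  have us : (crd (up x)).1 = s by rewrite -xs ej side_kid up_kid.
  have [|p [pp lp pF]] := IH (up x) uF us; first by rewrite dep_up xm.
  exists (inA (up x) :: p); split=> //=.
    rewrite adjA xm pp andbT /= andbT; apply/adjP; by exists None.
  move=> z; rewrite inE => /predU1P[->|/pF //].
  by rewrite in_planar_part uF us eqxx.
- move=> _ /planar_partP[x [-> xF xs]].
  have [l|nl] := pselect (image_leaf n phi x); [right | left] => _ /childA[j ->];
    rewrite in_planar_part side_kid xs eqxx andbT.
    exact: (image_leaf_kid hphi).
  exact: (inner_kid hphi).
Qed.

Definition planar_minus F :=
  rforest_minus A (planar_part F false `|` planar_part F true)%fset.

Lemma planar_minus_model n F phi : 0 < n -> complement_iso n F phi ->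
  deep_model n (planar_minus F) (inA \o phi).
Proof.
move=> n0 hphi; have [pi pa pd pF] := hphi.
pose G := (planar_part F false `|` planar_part F true)%fset.
have GE x : (inA x \in G) = (x \in F).
  by rewrite in_fsetU !in_planar_part -andb_orr; case: (crd x).1; rewrite andbT.
have leafP y : y \in F ->
    all (fun w => ~~ child A (inA y) w) G = `[< image_leaf n phi y >].
  move=> yF; apply/allP/asboolP => [h|l w wG].
    apply: contrapT => nl; have := inner_kid hphi (Ordinal q_gt0) yF nl.
    by rewrite -GE => /h /negP; apply; apply/childA; eexists.
  apply/negP => /childA[j ew]; move: wG; rewrite ew GE.
  by rewrite (negbTE (image_leaf_kid hphi j l)).
have vA x : rf_vert A (inA x) by apply/vertA; exists x.
have vE y : rf_vert (planar_minus F) (inA y) <-> exists2 x, n <= dep x & phi x = y.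
  rewrite (image_deepP hphi) /= -/G GE vA.
  case: (boolP (y \in F)) => yF /=; last by split=> // _; left.
  by rewrite negbK leafP //; split=> [/asboolP|[//|/asboolP]]; [right|].
split.
- move=> w; split=> [vw|[x nx <-]]; last by apply/vE; exists x.
  have /vertA[y ey] : rf_vert A w by case/andP: vw.
  by subst w; have [x nx <-] := (vE y).1 vw; exists x.
- by move=> x y nx ny /(can_inj inAK); exact: pi.
- move=> x y nx ny; have vx := (vE (phi x)).2 (ex_intro2 _ _ x nx erefl).
  have vy := (vE (phi y)).2 (ex_intro2 _ _ y ny erefl).
  rewrite /= in vx vy *; rewrite vx vy /= adjA pa // -/G !GE !(in_F_phi hphi) //.
  case axy: (adj x y) => //=.
  have [nx'|nx'] := eqVneq (dep x) n; have [ny'|ny'] := eqVneq (dep y) n => /=.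
  + by case/adjP: axy => -[j|] /(congr1 dep) /=; rewrite ?dep_kid ?dep_up; lia.
  + by rewrite andbT addn_gt0 (pd y) ?orbT // ltn_neqAle eq_sym ny'.
  + by rewrite andbT addn_gt0 (pd x) // ltn_neqAle eq_sym nx'.
  + by rewrite andbT addn_gt0 (pd y) ?orbT // ltn_neqAle eq_sym ny'.
- move=> x nx /=; rewrite -/G GE (in_F_phi hphi) //; case: eqP => //= xn.
  rewrite leafP ?(in_F_phi hphi) ?xn //; apply/asboolP; by exists x.
- by move=> w w' /and4P[].
Qed.

Lemma planar_minus_iso n F psi : 0 < n -> complement_iso n F psi ->
    (forall x j, n <= dep x -> psi (kid x j) = kid (psi x) j) ->
  planar_iso (planar_minus (ball n)) le (planar_minus F) le (inA \o psi \o i).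
Proof.
move=> n0 hpsi hkid; have mb := planar_minus_model n0 (complement_iso_ball n).
split.
  by apply: (deep_model_iso mb (planar_minus_model n0 hpsi)) => x nx /=; rewrite inAK.
move=> w _ w1 w2 /(deep_model_child n0 mb)[x [j [nx ex ->]]].
move=> /(deep_model_child n0 mb)[y [k [ny ey ->]]] /=.
have eyx : y = x by apply: (can_inj inAK); exact: etrans (esym ey) ex.
by rewrite eyx !inAK !hkid // !leA.
Qed.

(** Every end of T has a ray that avoids e, so it comes from an end of the
    planar forest. *)
Lemma exists_ends_bij : exists (f : ends (rf_adj A) -> ends adj)
    (g : ends adj -> ends (rf_adj A)),
  [/\ cancel f g, cancel g f, induced (rf_adj A) i f
    & forall E r, end_rays E r -> is_ray (rf_adj A) (inA \o r) ->
        end_rays (g E) (inA \o r)].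
Proof.
have iA r : is_ray (rf_adj A) r -> inA \o (i \o r) = r /\ is_ray adj (i \o r).
  move=> [ri ra]; have e : inA \o (i \o r) = r.
    apply/funext => m /=; have [/vertA[x <-] _] := adj_vertA (ra m).
    by rewrite inAK.
  split=> //; split=> [m m' emm|m].
    apply: ri; rewrite -[r m](congr1 (@^~ m) e) -[r m'](congr1 (@^~ m') e).
    exact: congr1 emm.
  have := ra m; by rewrite -e /= adjA !inAK => /andP[].
have [||f [g [fK gK hf hg]]] := @exists_end_bij _ _ (rf_adj A) adj i inA.
- move=> E; have [r Er] := end_ray E; have [e hr] := iA r (end_rays_is_ray Er).
  by exists r.
- move=> E; have [r Er rS] := end_ray_avoid E [fset base; up base]%fset.
  have rdep m : 0 < dep (r m).
    rewrite lt0n; apply: contra (rS m) => /eqP /[dup] r0 /dep0_base[->|<-];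
    rewrite !inE ?eqxx //.
    by rewrite up_up // eqxx orbT.
  exists r; split=> //; last by apply/funext => m /=; rewrite inAK.
  apply: (@is_ray_map _ _ adj _ (fun x => 0 < dep x)) => //.
  + by move=> x y _ _ /(can_inj inAK).
  + by move=> x y x0 y0 axy; rewrite adjA axy addn_gt0 x0.
  + exact: end_rays_is_ray Er.
exists f, g; split=> // E r Er /iA[_ hr]; exact: hf.
Qed.

(** The finite subtrees contain the two roots, so no edge outside them is the
    edge e, which the planar forest lacks. *)
Lemma Higman_Thompson_spheromorphism g :
  Higman_Thompson_embedded adj A le r1 r2 i g -> spheromorphism g.
Proof.
case=> Phi [F1 [F2 [F1' [F2' [phi [[[r1F _ _] [r2F _ _]]
  [[r1F' _ _] [r2F' _ _]] [iso _] ind]]]]]].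
case=> f [f' [hf fK f'K gE]].
have [phi' [h1 h2 h3]] := cut_iso_off iso.
(* The filter removes the images of elements of S that are not vertices. *)
pose T (S : {fset W}) := [fset x in [fset i w | w in S] | inA x \in S]%fset.
have TE S x : (x \in T S) = (inA x \in S).
  rewrite !inE /=; case: (boolP (inA x \in S)) => xS; last by rewrite andbF.
  by rewrite andbT; apply/imfsetP; exists (inA x); rewrite ?inAK.
have depT (S : {fset W}) x : r1 \in S -> r2 \in S -> inA x \notin S -> 0 < dep x.
  move=> r1S r2S; rewrite lt0n; apply: contra; rewrite -{2}[x]crdK /dep.
  by case: (crd x) => s [|//] _; rewrite inA_root; case: s.
have vA x : rf_vert A (inA x) by apply/vertA; exists x.
have iA w : rf_vert A w -> inA (i w) = w by move=> /vertA[x <-]; rewrite inAK.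
set S1 := (F1 `|` F2)%fset in iso ind h1 h2 h3.
set S2 := (F1' `|` F2')%fset in iso ind h1 h2 h3.
have r1S1 : r1 \in S1 by rewrite inE r1F.
have r2S1 : r2 \in S1 by rewrite inE r2F orbT.
have r1S2 : r1 \in S2 by rewrite inE r1F'.
have r2S2 : r2 \in S2 by rewrite inE r2F' orbT.
exists (T S1), (T S2), (i \o phi \o inA), (i \o phi' \o inA); split => /=.
- move=> x; rewrite !TE => /(h1 _ (vA x))[vp pS e].
  by rewrite iA // e inAK.
- move=> x; rewrite !TE => /(h2 _ (vA x))[vp pS e].
  by rewrite iA // e inAK.
- move=> x y; rewrite !TE => xS yS.
  have [vx xS' _] := h1 _ (vA x) xS; have [vy yS' _] := h1 _ (vA y) yS.
  have := h3 _ _ (vA x) (vA y) xS yS.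
  rewrite -{1}[phi (inA x)]iA // -{1}[phi (inA y)]iA // !adjA.
  by rewrite !addn_gt0 (depT S1 x) // (depT S2 (i (phi (inA x)))) ?iA // !andbT.
move=> E r Er rT; have rS m : inA (r m) \notin S1 by rewrite -TE.
have rr : is_ray (rf_adj A) (inA \o r).
  apply: (@is_ray_map _ _ adj _ (fun x => inA x \notin S1)) => //.
  + by move=> x y _ _ /(can_inj inAK).
  + by move=> x y xS yS axy; rewrite adjA axy addn_gt0 (depT S1).
  + exact: end_rays_is_ray Er.
have Er' : end_rays (f' E) (inA \o r).
  have [s Es] := end_ray (f' E); have sr := end_rays_is_ray Es.
  have := hf _ _ Es sr; rewrite f'K => Eis.
  apply: (end_rays_closed Es rr).
  have -> : s = inA \o (i \o s).
    by apply/funext => m /=; rewrite iA //; have [_ /(_ m)/adj_vertA[]] := sr.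
  exact: tail_eq_comp (end_rays_tail Eis Er).
rewrite gE /=; have Ephi := ind _ _ Er' _.
have {}Ephi : end_rays (Phi (f' E)) (phi \o (inA \o r)).
  apply: Ephi; case: rr => ri ra; split=> // m /=.
  by rewrite !vA /= (negbTE (rS m)) (negbTE (rS m.+1)) /= andbT; exact: ra.
exact: hf Ephi (end_rays_is_ray Ephi).
Qed.

(** With h induced by [relabel], the map f * h is induced by the planar
    isomorphism phi \o relabel. *)
Lemma spheromorphism_factor (c : V -> bool) (f : Defs.bij (ends adj)) :
    two_coloring adj c -> spheromorphism f ->
  exists g h, [/\ Higman_Thompson_embedded adj A le r1 r2 i g, Aut_plus adj c h
    & f = (g * h^-1)%g].
Proof.
move=> hc /spheromorphism_complement[n [F [phi [phi' [n0 hphi phiK ind]]]]].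
pose al := relabel n phi phi'.
have ali : injective al := relabel_inj hphi phiK.
have ala x y : adj (al x) (al y) = adj x y by exact: (relabel_adj hphi phiK).
have /choice[al' al'K] : forall y, exists x, al x = y by exact: (relabel_onto hphi phiK).
have alK : cancel al al' by move=> x; apply: ali; rewrite al'K.
have ral r : is_ray adj r -> is_ray adj (al \o r).
  move=> rr; apply: (@is_ray_map _ _ adj _ (fun=> True)) => // x y _ _; first exact: ali.
  by rewrite ala.
have ral' r : is_ray adj r -> is_ray adj (al' \o r).
  move=> rr; apply: (@is_ray_map _ _ adj _ (fun=> True)) => // x y _ _.
    exact: (can_inj al'K).
  by rewrite -[adj (al' _) _]ala !al'K.
have [||h [h' [hK h'K hal _]]] := @exists_end_bij _ _ adj adj al al'.
- move=> E; have [r Er] := end_ray E; exists r; split=> //.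
    exact: ral (end_rays_is_ray Er).
  by apply/funext => m /=; rewrite alK.
- move=> E; have [r Er] := end_ray E; exists r; split=> //.
    exact: ral' (end_rays_is_ray Er).
  by apply/funext => m /=; rewrite al'K.
pose H : Defs.bij (ends adj) := Defs.Bij hK h'K.
exists (f * H)%g, H; split; last by rewrite mulgK.
- have [I [J [IK JK hI hJ]]] := exists_ends_bij.
  pose G := (f * H)%g; have hG := complement_iso_relabel hphi phiK.
  have GK : cancel (J \o G \o I) (J \o bij_inv G \o I).
    by move=> E; rewrite /comp JK bij_funK IK.
  have KG : cancel (J \o bij_inv G \o I) (J \o G \o I).
    by move=> E; rewrite /comp JK bij_invK IK.
  exists (Defs.Bij GK KG); last by exists I, J; split=> // E; rewrite /= !JK.
  have hb := complement_iso_ball n; have mb := planar_minus_model n0 hb.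
  exists (planar_part (ball n) false), (planar_part (ball n) true).
  exists (planar_part F false), (planar_part F true), (inA \o (phi \o al) \o i).
  split.
  + split; first exact: (planar_part_subtree false hb).
    exact: (planar_part_subtree true hb).
  + split; first exact: (planar_part_subtree false hG).
    exact: (planar_part_subtree true hG).
  + apply: (planar_minus_iso n0 hG) => x j nx /=; exact: (phi_relabel_kid hphi phiK).
  move=> E r Er [ri ra].
  have deepr m : n <= dep (i (r m)) /\ inA (i (r m)) = r m.
    have [vb _ _ _ hv] := mb; have [/vb[x nx <-] _] := hv _ _ (ra m).
    by rewrite /= inAK.
  have rr := end_rays_is_ray Er.
  have ir : end_rays (I E) (i \o r) by exact: hI.
  have air : end_rays (h (I E)) (al \o (i \o r)).
    by apply: hal => //; apply: ral; exact: end_rays_is_ray ir.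
  have gr : end_rays (G (I E)) (phi \o (al \o (i \o r))).
    apply: ind => // m; rewrite /= (dep_relabel hphi phiK); by case: (deepr m).
  apply: hJ => //; have [pi pa pd _] := hG.
  have [_ vi va _ _] := planar_minus_model n0 hG.
  have [_ _ va' _ _] := mb.
  suff [ri' ra'] : is_ray (rf_adj (planar_minus F)) ((inA \o (phi \o al)) \o (i \o r)).
    by split=> // m; have /and4P[] := ra' m.
  apply: (@is_ray_map _ _ adj _ (fun x => n <= dep x)); last by move=> m; case: (deepr m).
  + exact: vi.
  + by move=> x y nx ny; rewrite va.
  + exact: end_rays_is_ray ir.
- exists al; split=> //; first by exists al'.
    exact: (relabel_color hphi phiK hc).
  move=> E r Er rr; apply: hal => //; exact: ral.
Qed.

End PlanarModel.
End CoordinatizedTree.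

(** * Generation *)

Theorem lemma6p2 (q : nat) (hq : 2 <= q)
    (V : choiceType) (adj : rel V) (hT : regular_tree q adj)
    (c : V -> bool) (hc : two_coloring adj c)
    (W : choiceType) (A : rforest W) (le : rel W) (r1 r2 : W)
    (hA : regular_rforest q A) (hle : planar A le)
    (hr12 : r1 != r2) (hr : rf_root A =1 pred2 r1 r2)
    (a b : V) (hab : adj a b)
    (i : W -> V) (hi : rforest_iso A (tree_minus adj [fset a; b]%fset) i) :
  Neretin adj q
    = generated_subgroup (Aut_plus adj c `|` Higman_Thompson_embedded adj A le r1 r2 i).
Proof.
case: hT => adjC adjN _ _ degE.
have [posW [posW_inj vertW rootW childW leW]] := forest_coordinates hA hle hr12 hr.
have [[iV i_inj i_onto] i_adj i_root] := hi.
have ab : a != b by apply: contraTneq hab => ->; rewrite adjN.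
(* The edge e is a subtree whose two vertices are leaves, so that removing it
   keeps all vertices and makes its end points the roots. *)
have leaf x : x \in [fset a; b]%fset -> subdegree adj [fset a; b]%fset x == 1.
  move=> xab; apply/cardfs1P; exists (if x == a then b else a).
  apply/fsetP => y; rewrite !inE /=; move: xab; rewrite !inE.
  have [-> _|_ /= /eqP ->] := eqVneq x a.
    by apply/andP/eqP => [[/orP[/eqP->|/eqP->]]|->]; rewrite ?adjN // hab eqxx orbT.
  by apply/andP/eqP => [[/orP[/eqP->|/eqP->]]|->]; rewrite ?adjN // adjC hab eqxx.
have kept x : rf_vert (tree_minus adj [fset a; b]%fset) x.
  by rewrite /=; case: (boolP (x \in _)) => // /leaf ->.
have vW d : rf_vert A (posW d) by apply/vertW; exists d.
pose pos d := i (posW d).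
have pos_inj d d' : pos d = pos d' -> d = d'.
  by move/i_inj => e; apply: posW_inj; apply: e; rewrite inE; exact: vW.
have /choice[crd crdK] : forall v, exists d, pos d = v.
  by move=> v; have [w /vertW[d <-] <-] := i_onto v (kept v); exists d.
have posK : cancel pos crd by move=> d; apply: pos_inj; rewrite crdK.
have pos_root d : (pos d \in [fset a; b]%fset) = nilp d.2.
  have := i_root _ (vW d); rewrite /= -/(pos d) andb_idr; last exact: leaf.
  move=> ->; rewrite hr /=; case: d => s [|j u] /=.
    by rewrite rootW; case: s; rewrite eqxx ?orbT.
  have e0 := rootW false; have e1 := rootW true; rewrite /= in e0 e1.
  by rewrite -e0 -e1 !(inj_eq posW_inj) !xpair_eqE /= !andbF.
have adj_rootP x y : x \in [fset a; b]%fset -> y \in [fset a; b]%fset ->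
    adj x y = (x != y).
  rewrite !inE => /orP[]/eqP-> /orP[]/eqP->; rewrite ?adjN ?eqxx ?hab ?ab //.
  by rewrite adjC hab eq_sym ab.
have adjW d d' : rf_adj A (posW d) (posW d')
    = adj (pos d) (pos d') && ~~ (nilp d.2 && nilp d'.2).
  rewrite -(i_adj _ _ (vW d) (vW d')) -!pos_root.
  by have := kept (pos d); have := kept (pos d'); rewrite /= => -> ->.
have adjWP d d' : rf_adj A (posW d) (posW d') <->
    (exists j, d' = extend d j) \/ (exists j, d = extend d' j).
  split=> [/(adj_child hA)[]/childW[j /posW_inj ->]|[]]; [by left; exists j|by right; exists j| |].
    by case=> j ->; apply: (@child_adj _ A); apply/childW; exists j.
  case: hA => -[AC _ _ _] _ _ _ [j ->].
  by rewrite AC; apply: (@child_adj _ A); apply/childW; exists j.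
have adj_pos d d' :
    adj (pos d) (pos d') = (d == up_address d') || (d' == up_address d).
  have [/andP[n0 n0']|nn] := boolP (nilp d.2 && nilp d'.2).
    rewrite adj_rootP ?pos_root // (inj_eq pos_inj).
    case: d d' n0 n0' => [s [|//]] [s' [|//]] _ _.
    by case: s; case: s'.
  have := adjW d d'; rewrite nn andbT => <-; apply/idP/idP.
    move/adjWP => [[j ->]|[j ->]]; rewrite /extend /up_address /= -surjective_pairing eqxx //.
    by rewrite orbT.
  case: d d' nn => [s u] [s' u'] nn h; apply/adjWP.
  case/orP: h nn; rewrite /up_address /=.
    by case: u' => [|j u'] /eqP[-> ->] //= _; left; exists j.
  by case: u => [|j u] /eqP[-> ->] //= _; right; exists j.
pose inA v := posW (crd v).
have inAK : cancel inA i by move=> v; exact: crdK.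
have inA_pos d : inA (pos d) = posW d by rewrite /inA posK.
have vertA w : rf_vert A w <-> exists x, inA x = w.
  split=> [/vertW[d <-]|[x <-]]; last exact: vW.
  by exists (pos d).
have childA x w : child A (inA x) w <-> exists j, w = inA (kid pos crd x j).
  by rewrite childW; split=> -[j ->]; exists j; rewrite inA_pos.
have leA x (j k : 'I_q) :
    le (inA (kid pos crd x j)) (inA (kid pos crd x k)) = (j <= k).
  by rewrite !inA_pos leW.
have adjA x y :
    rf_adj A (inA x) (inA y) = adj x y && (0 < dep crd x + dep crd y).
  by rewrite adjW -/(inA x) /pos -/(inA x) -/(inA y) !inAK lt0n addn_eq0.
have adj_vertA w w' : rf_adj A w w' -> rf_vert A w /\ rf_vert A w'.
  by case: hA => -[_ _ h _] _ _ _ /h/andP.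
have inA_root (s : bool) : inA (pos (s, [::])) = if s then r2 else r1.
  by rewrite inA_pos rootW.
have q_gt0 := ltnW hq.
have NE := Neretin_spheromorphism adjC degE posK crdK adj_pos q_gt0.
have {}NE : Neretin adj q = [set f | spheromorphism f].
  by apply/seteqP; split=> f /NE.
rewrite NE; apply/seteqP; split=> [f sf H [[_ hdiv] hH]|]; last first.
  apply: smallest_sub; first exact: spheromorphism_group.
  move=> f [|gHT]; last first.
    have := Higman_Thompson_spheromorphism crdK inAK vertA adjA adj_vertA inA_root gHT.
    exact.
  case=> al [[al' alK al'K] ala _ ind].
  exists fset0, fset0, al, al'; split=> // E r Er _.
  exact: ind Er (end_rays_is_ray Er).
have [g [h [gHT hAut ->]]] := spheromorphism_factor adjC posK crdK adj_pos
  q_gt0 inAK vertA childA leA adjA adj_vertA inA_root hc sf.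
have Hg : g \in H by rewrite inE; apply: hH; right.
have Hh : h \in H by rewrite inE; apply: hH; left.
by have := hdiv g h Hg Hh; rewrite inE.
Qed.
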